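(* Let $F>0$ be fixed and, for integers $N\ge 3$ and $\varepsilon=1/N$, let $y_F$ be the uniform circular configuration of $N$ atoms with nearest neighbor interatomic spacing $F\varepsilon$. Then, as $\varepsilon\to0$, $$\inf_{u\in\mathcal U\setminus\{0\}}\frac{\delta^2\mathcal E^{\mathrm{CB}}(y_F)[u,u]}{\|u'\|_{\ell^2_\varepsilon}^2}=\begin{cases}\min\left\{\phi''(F)+4\,\phi''(2F),\ \dfrac{\phi'(F)+2\,\phi'(2F)}{F}\right\}&\text{if }N\text{ is even},\\[2mm]\min\left\{\phi''(F)+4\,\phi''(2F),\ \dfrac{\phi'(F)+2\,\phi'(2F)}{F}+\mathcal O(\varepsilon)\right\}&\text{if }N\text{ is odd}.\end{cases}$$
   Context: Let $\varepsilon=1/N$. $\mathcal Y$ is the set of sequences $y=\{y_\ell\}_{\ell\in\mathbb Z}$, $y_\ell\in\mathbb R^2$, with $y_{\ell+N}=y_\ell+(y_N-y_0)$ for all $\ell$. $\mathcal U$ is the set of $N$-periodic sequences $u=\{u_\ell\}_{\ell\in\mathbb Z}$ in $\mathbb R^2$ with $\sum_{\ell=1}^N u_\ell=0$. Backward difference: $y'_\ell=(y_\ell-y_{\ell-1})/\varepsilon$. $\|\cdot\|$ is the Euclidean norm on $\mathbb R^2$ and $\|v\|_{\ell^2_\varepsilon}=\left(\varepsilon\sum_{\ell=1}^N\|v_\ell\|^2\right)^{1/2}$. The pair potential $\phi:(0,\infty)\to\mathbb R$ is twice continuously differentiable. The Cauchy--Born energy is $\mathcal E^{\mathrm{CB}}(y)=\varepsilon\sum_{\ell=1}^N[\phi(\|y'_\ell\|)+\phi(2\|y'_\ell\|)]$.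 The second variation is $\delta^2\mathcal E(y)[u,v]=\frac{\partial^2}{\partial s\,\partial t}\mathcal E(y+su+tv)\big|_{s=t=0}$. The uniform circular configuration is $(y_F)_\ell=R(\cos(2\pi\varepsilon\ell),\sin(2\pi\varepsilon\ell))$ with $R$ determined by $F\varepsilon=2R\sin(\pi\varepsilon)$ (up to rigid motions). $\mathcal O(\varepsilon)$ denotes a real quantity $r_N$ with $|r_N|\le C\varepsilon$ for all sufficiently large odd $N$, with $C$ depending only on $\phi$ and $F$. *)

(* Defs.v *)
From HB Require Import structures.
From mathcomp Require Import all_boot all_order all_algebra.
From mathcomp Require Import all_classical all_reals all_analysis.
Import Order.TTheory GRing.Theory Num.Theory.
Import numFieldNormedType.Exports.

Set Implicit Arguments.
Unset Strict Implicit.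
Unset Printing Implicit Defensive.

Local Open Scope ring_scope.
Local Open Scope classical_set_scope.

Section CauchyBorn.
Context {R : realType}.
Implicit Types (phi : R -> R) (F : R) (N : nat) (y u v : int -> 'rV[R]_2).

(* The canonical norm on 'rV[R]_2 is the sup norm, hence this definition. *)
Definition enorm (x : 'rV[R]_2) : R := Num.sqrt (\sum_i x 0 i ^+ 2).

Definition eps N : R := N%:R^-1.

Definition bdiff N y : int -> 'rV[R]_2 :=
  fun l => (eps N)^-1 *: (y l - y (l - 1)).

Definition l2norm N v : R :=
  Num.sqrt (eps N * \sum_(1 <= l < N.+1) enorm (v l%:Z) ^+ 2).

Definition deformations N : set (int -> 'rV[R]_2) :=
  [set y | forall l : int, y (l + N%:Z) = y l + (y N%:Z - y 0)].

Definition displacements N : set (int -> 'rV[R]_2) :=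
  [set u | (forall l : int, u (l + N%:Z) = u l) /\
           \sum_(1 <= l < N.+1) u l%:Z = 0].

(* [phi] is a total function, but only its restriction to ]0, +oo[ matters:
   derivatives at a positive point are local. *)
Definition C2_pos phi : Prop :=
  forall x : R, 0 < x ->
    [/\ derivable phi x 1, derivable (derive1 phi) x 1 &
        {for x, continuous (derive1n 2 phi)}].

Definition energyCB phi N y : R :=
  eps N * \sum_(1 <= l < N.+1)
    (phi (enorm (bdiff N y l%:Z)) + phi (2 * enorm (bdiff N y l%:Z))).

Definition second_variation (E : (int -> 'rV[R]_2) -> R) y u v : R :=
  derive1 (fun s : R => derive1 (fun t : R => E (y + s *: u + t *: v)) 0) 0.

(* Circular configuration of nearest neighbour spacing [F * eps N], up to an
   arbitrary isometry [x |-> x *m Q + c] of the plane. *)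
Definition uniform_circular F N y : Prop :=
  exists2 rad : R, F * eps N = 2 * rad * sin (pi * eps N) &
  exists2 Q : 'M[R]_2, Q *m Q^T = 1%:M &
  exists c : 'rV[R]_2, forall l : int,
    y l = (\row_(i < 2) (rad * (if i == 0 then cos (2 * pi * eps N * l%:~R)
                                else sin (2 * pi * eps N * l%:~R)))) *m Q + c.

Lemma uniform_circular_deformation F N y : (0 < N)%N ->
  uniform_circular F N y -> deformations N y.
Proof.
move=> N0 [rad _ [Q _ [c yE]]] l.
have per (k : int) : y (k + N%:Z) = y k.
  rewrite !yE; congr (_ *m Q + c); apply/rowP => i; rewrite !mxE.
  have -> : 2 * pi * eps N * (k + N%:Z)%:~R = 2 * pi * eps N * k%:~R + pi *+ 2 :> R.
    rewrite intrD mulrDr -pmulrn -[2 * pi * _ * N%:R]mulrA mulVf ?mulr1 ?mulr_natl//.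
    by rewrite pnatr_eq0 -lt0n.
  by rewrite cosD2pi sinD2pi.
by rewrite per -{1}[N%:Z]add0r per subrr addr0.
Qed.

Lemma deformations_add N y u : deformations N y -> displacements N u ->
  deformations N (y + u).
Proof.
move=> yN [uN _] l.
have uN0 : u N%:Z = u 0 by rewrite -[N%:Z]add0r uN.
have addE k : (y + u) k = y k + u k by [].
by rewrite !addE yN uN uN0 [y 0 + u 0]addrC addrKA addrAC.
Qed.

End CauchyBorn.

(* Main.v *)
(* Write [t_l] for the component of [u'_l] along the bond [y'_l], which has
   length [F].  With [a] and [b] the first and second arguments of the minimum,
   each bond contributes [a t_l ^ 2 + b (|u'_l| ^ 2 - t_l ^ 2)] to the second
   variation, so the Rayleigh quotient is at least [min a b].  The dilation
   [u = y - mean y] has [u' = y'] and quotient [a]; the infinitesimal rotation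
   obtained from it by a quarter turn has [u'] normal to [y'] and quotient [b].
   Both are admissible whatever the parity of [N], so the [O(eps)] correction
   can be taken to be zero. *)
Require Import Defs.
From HB Require Import structures.
From mathcomp Require Import all_boot all_order all_algebra.
From mathcomp Require Import all_classical all_reals all_analysis.
From mathcomp Require Import ring.
Import Order.TTheory GRing.Theory Num.Theory.
Import numFieldNormedType.Exports.

Local Open Scope ring_scope.
Local Open Scope classical_set_scope.

(** * Second derivatives at the origin *)

Definition has_deriv2_at0 {R : realType} (h : R -> R) (d : R) : Prop :=
  exists2 h1 : R -> R,
    (\forall s \near (0 : R), is_derive (s : R) 1 h (h1 s)) & is_derive (0 : R) 1 h1 d.

Lemma has_deriv2_sum {R : realType} (I : Type) (r : seq I) (h : I -> R -> R) (d : I -> R) :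
  (forall i, has_deriv2_at0 (h i) (d i)) ->
  has_deriv2_at0 (fun s => \sum_(i <- r) h i s) (\sum_(i <- r) d i).
Proof.
move=> hd; elim: r => [|i r [g g1 g2]].
  rewrite big_nil; under eq_fun do rewrite big_nil.
  exists (cst 0); last exact: is_derive_cst.
  by near=> s; exact: is_derive_cst.
rewrite big_cons; under eq_fun do rewrite big_cons.
have [k k1 k2] := hd i.
exists (k \+ g); last exact: is_deriveD.
by near=> s; apply: is_deriveD; near: s.
Unshelve. all: by end_near. Qed.

Lemma has_deriv2_scale {R : realType} (c : R) (h : R -> R) (d : R) :
  has_deriv2_at0 h d -> has_deriv2_at0 (fun s => c * h s) (c * d).
Proof.
move=> [g g1 g2]; exists (fun s => c * g s); last exact: is_deriveZ.
by near=> s; apply: is_deriveZ; near: s.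
Unshelve. all: by end_near. Qed.

(** For [s] near 0 the inner derivative is [h'(s)] by the chain rule. Agreement near 0 fixes the
    outer derivative, so [has_deriv2_at0] asks for a first derivative only there. *)
Lemma has_deriv2_derive1 {R : realType} (h : R -> R) (d : R) :
  has_deriv2_at0 h d ->
  derive1 (fun s => derive1 (fun t => h (s + t)) 0) 0 = d.
Proof.
move=> [g g1 g2].
have g3 : is_derive (0 : R) 1 (fun s => derive1 (fun t => h (s + t)) 0) d.
  apply: near_eq_is_derive g2; near=> s.
  have gs : is_derive (s : R) 1 h (g s) by near: s.
  rewrite derive1E.
  have : is_derive (0 : R) 1 (fun t => h (s + t)) (g s * 1).
    apply: (@is_derive1_comp _ h (fun t => s + t)); first by rewrite addr0.
    by apply: is_derive_eq; rewrite ?add0r mulr1.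
  by move=> gg; rewrite derive_val mulr1.
by rewrite derive1E derive_val.
Unshelve. all: by end_near. Qed.

(** Serves both orders of differentiation of the bond energy: [f = phi] with [c = 1], then
    [f = phi'] with [c = 2], which produces the factor 4. *)
Lemma is_derive_scaled_sum {R : realType} (f : R -> R) (c x : R) :
  derivable f x 1 -> derivable f (2 * x) 1 ->
  is_derive x 1 (fun r => f r + c * f (2 * r))
    (derive1 f x + c * 2 * derive1 f (2 * x)).
Proof.
move=> /derivableP fx /derivableP f2x.
have f2 : is_derive x 1 (fun r => f (2 * r)) ('D_1 f (2 * x) * 2).
  apply: (@is_derive1_comp _ f (fun r => 2 * r)).
  by apply: is_derive_eq; rewrite ?scaler0 ?addr0 /GRing.scale/= mulr1.
apply: is_derive_eq (is_deriveD fx (is_deriveZ c f2)) _.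
by rewrite !derive1E /GRing.scale/=; ring.
Qed.

Lemma is_derive_sqrt_quadratic {R : realType} (A p m s : R) :
  0 < A + 2 * p * s + m * s ^+ 2 ->
  is_derive s 1 (fun s => Num.sqrt (A + 2 * p * s + m * s ^+ 2))
    ((p + m * s) / Num.sqrt (A + 2 * p * s + m * s ^+ 2)).
Proof.
move=> q0.
have dq : is_derive s 1 (fun s => A + 2 * p * s + m * s ^+ 2) (2 * (p + m * s)).
  apply: is_derive_eq.
  rewrite /GRing.scale/=; ring.
have := @is_derive1_comp _ (@Num.sqrt R) _ s _ _ (is_derive1_sqrt q0) dq.
move=> dn; apply: is_derive_eq.
by field; rewrite gt_eqF// sqrtr_gt0.
Qed.

(** The root [n(s)] has [n(0) = F], [n'(0) = p / F] and [n''(0) = (m - (p / F) ^ 2) / F]; the claim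
    is [W''(F) n'(0) ^ 2 + W'(F) n''(0)]. *)
Lemma has_deriv2_comp_sqrt_quadratic {R : realType} (W W1 : R -> R) (W2 F p m : R) :
  0 < F -> (forall x : R, 0 < x -> is_derive x 1 W (W1 x)) -> is_derive F 1 W1 W2 ->
  has_deriv2_at0 (fun s => W (Num.sqrt (F ^+ 2 + 2 * p * s + m * s ^+ 2)))
    (W2 * (p / F) ^+ 2 + W1 F / F * (m - (p / F) ^+ 2)).
Proof.
move=> F0 dW dW1; set q := fun s => F ^+ 2 + 2 * p * s + m * s ^+ 2.
have q0 : q 0 = F ^+ 2 by rewrite /q expr0n/= !mulr0 !addr0.
have nF : Num.sqrt (q 0) = F by rewrite q0 sqrtr_sqr gtr0_norm.
exists (fun s => W1 (Num.sqrt (q s)) * ((p + m * s) / Num.sqrt (q s))).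
  (* Near 0 the bond does not collapse, so the root is differentiable and [W] is evaluated at
     positive lengths. *)
  have qpos : \forall s \near (0 : R), 0 < q s.
    have cq : q x @[x --> (0 : R)] --> q 0.
      apply: (@differentiable_continuous _ R^o R^o).
      by apply/derivable1_diffP; apply: ex_derive.
    by apply: (cvgr_gt _ cq); rewrite q0 exprn_gt0.
  near=> s.
  have qs : 0 < q s by near: s.
  apply: (@is_derive1_comp _ W (fun s => Num.sqrt (q s))).
    by apply: dW; rewrite sqrtr_gt0.
  exact: is_derive_sqrt_quadratic.
have dn : is_derive (0 : R) 1 (fun s => Num.sqrt (q s)) ((p + m * 0) / Num.sqrt (q 0)).
  by apply: is_derive_sqrt_quadratic; rewrite -/(q 0) q0 exprn_gt0.
have dW1' : is_derive (Num.sqrt (q 0)) 1 W1 W2 by rewrite nF.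
have d1 := @is_derive1_comp _ W1 _ 0 _ _ dW1' dn.
have n0 : Num.sqrt (q 0) != 0 by rewrite nF gt_eqF.
have d2 := @is_deriveV _ (fun s => Num.sqrt (q s)) 0 _ _ n0 dn.
have d3 : is_derive (0 : R) 1 (fun s => p + m * s) m.
  by apply: is_derive_eq; rewrite /GRing.scale/=; ring.
have d4 := is_deriveM d1 (is_deriveM d3 d2).
apply: (@is_derive_eq _ _ _ _ _ _ _ _ d4).
by rewrite /GRing.scale/= fctE nF; field; rewrite gt_eqF.
Unshelve. all: by end_near. Qed.

(** * Euclidean geometry of the plane *)

Definition dot {R : realType} (x v : 'rV[R]_2) : R := \sum_i x 0 i * v 0 i.

Lemma enorm_sq {R : realType} (x : 'rV[R]_2) : enorm x ^+ 2 = dot x x.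
Proof.
rewrite sqr_sqrtr; first by apply: eq_bigr => i _; rewrite expr2.
by apply: sumr_ge0 => i _; exact: sqr_ge0.
Qed.

Lemma enorm_ge0 {R : realType} (x : 'rV[R]_2) : 0 <= enorm x.
Proof. exact: sqrtr_ge0. Qed.

Lemma enorm_eq0 {R : realType} (x : 'rV[R]_2) : enorm x = 0 -> x = 0.
Proof.
move=> x0; have : dot x x = 0 by rewrite -enorm_sq x0 expr0n.
move/psumr_eq0P => h; apply/rowP => i; rewrite mxE.
apply/eqP; rewrite -sqrf_eq0 expr2; apply/eqP/h => // j _.
by rewrite -expr2 sqr_ge0.
Qed.

Lemma enorm_sqrt_sq {R : realType} (x : 'rV[R]_2) : enorm x = Num.sqrt (enorm x ^+ 2).
Proof. by rewrite sqrtr_sqr ger0_norm ?enorm_ge0. Qed.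

Lemma enorm_line {R : realType} (x v : 'rV[R]_2) (s : R) :
  enorm (x + s *: v) =
  Num.sqrt (enorm x ^+ 2 + 2 * dot x v * s + enorm v ^+ 2 * s ^+ 2).
Proof.
rewrite enorm_sqrt_sq !enorm_sq /dot !big_ord_recl !big_ord0 !mxE.
by congr Num.sqrt; ring.
Qed.

(** By Lagrange's identity the gap is the square of the determinant of [x] and [v]. *)
Lemma dot_sq_le {R : realType} (x v : 'rV[R]_2) :
  dot x v ^+ 2 <= enorm x ^+ 2 * enorm v ^+ 2.
Proof.
rewrite !enorm_sq /dot !big_ord_recl !big_ord0 !addr0.
set a := x _ _; set b := x _ _; set c := v _ _; set d := v _ _.
rewrite -subr_ge0 (_ : _ - _ = (a * d - b * c) ^+ 2); last ring.
exact: sqr_ge0.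
Qed.

Lemma enorm_orthogonal {R : realType} (x : 'rV[R]_2) (Q : 'M[R]_2) :
  Q *m Q^T = 1%:M -> enorm (x *m Q) = enorm x.
Proof.
have dotE (z : 'rV[R]_2) : dot z z = (z *m z^T) 0 0.
  by rewrite mxE; apply: eq_bigr => i _; rewrite mxE.
move=> QQ; rewrite enorm_sqrt_sq [RHS]enorm_sqrt_sq !enorm_sq !dotE trmx_mul mulmxA.
by rewrite -(mulmxA x) QQ mulmx1.
Qed.

Lemma l2norm_sq {R : realType} N (v : int -> 'rV[R]_2) :
  l2norm N v ^+ 2 = eps N * \sum_(1 <= l < N.+1) enorm (v l%:Z) ^+ 2.
Proof.
rewrite sqr_sqrtr// mulr_ge0 ?invr_ge0//.
by apply: sumr_ge0 => l _; exact: sqr_ge0.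
Qed.

(** * Second variation of the Cauchy-Born energy *)

Lemma bdiff_line {R : realType} N (y u : int -> 'rV[R]_2) (s : R) l :
  bdiff N (y + s *: u) l = bdiff N y l + s *: bdiff N u l.
Proof.
rewrite /bdiff [(y + _) l]/GRing.add [(y + _) (l - 1)]/GRing.add/=.
rewrite [(s *: u) l]/GRing.scale [(s *: u) (l - 1)]/GRing.scale/=.
rewrite [in RHS]scalerA [s * _]mulrC -[in RHS]scalerA -scalerDr; congr (_ *: _).
by rewrite scalerBr opprD addrACA.
Qed.

(** With [W(r) = phi(r) + phi(2 r)] the energy of a bond, this is [W''(F)], its stiffness against
    stretching. *)
Definition tangential_modulus {R : realType} (phi : R -> R) (F : R) : R :=
  derive1n 2 phi F + 4 * derive1n 2 phi (2 * F).

(** This is [W'(F) / F], the bond tension over its length: the stiffness against motion normal to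
    the bond. *)
Definition normal_modulus {R : realType} (phi : R -> R) (F : R) : R :=
  (derive1 phi F + 2 * derive1 phi (2 * F)) / F.

Lemma second_variationCB {R : realType} (phi : R -> R) (F : R) N
    (y u : int -> 'rV[R]_2) :
  C2_pos phi -> 0 < F -> (forall l, enorm (bdiff N y l) = F) ->
  second_variation (energyCB phi N) y u u =
  eps N * \sum_(1 <= l < N.+1)
    (let t := dot (bdiff N y l%:Z) (bdiff N u l%:Z) / F in
     tangential_modulus phi F * t ^+ 2 +
     normal_modulus phi F * (enorm (bdiff N u l%:Z) ^+ 2 - t ^+ 2)).
Proof.
move=> C2 F0 yF.
pose W (r : R) := phi r + 1 * phi (2 * r).
pose W1 (r : R) := derive1 phi r + 2 * derive1 phi (2 * r).
have x2 (x : R) : 0 < x -> 0 < 2 * x by move=> ?; rewrite mulr_gt0.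
have dW (x : R) : 0 < x -> is_derive x 1 W (W1 x).
  move=> x0; have [p0 _ _] := C2 _ x0; have [p2 _ _] := C2 _ (x2 _ x0).
  by apply: is_derive_eq (is_derive_scaled_sum phi 1 _ p0 p2) _; rewrite mul1r.
have dW1 : is_derive F 1 W1 (tangential_modulus phi F).
  have [_ p0 _] := C2 _ F0; have [_ p2 _] := C2 _ (x2 _ F0).
  apply: is_derive_eq (is_derive_scaled_sum _ 2 _ p0 p2) _.
  by rewrite /tangential_modulus/= -natrM.
rewrite /second_variation.
pose h s := eps N * \sum_(1 <= l < N.+1)
  W (Num.sqrt (F ^+ 2 + 2 * dot (bdiff N y l%:Z) (bdiff N u l%:Z) * s
     + enorm (bdiff N u l%:Z) ^+ 2 * s ^+ 2)).
(* Both variations are along [u], so the energy depends on [s + t] alone and the mixed derivative is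
   [h''(0)]. *)
have -> : (fun s : R => derive1 (fun t : R => energyCB phi N (y + s *: u + t *: u)) 0)
       = (fun s : R => derive1 (fun t : R => h (s + t)) 0).
  apply/funext => s; congr (derive1 _ 0); apply/funext => t.
  rewrite -addrA -scalerDl /energyCB /h; congr (_ * _).
  by apply: eq_bigr => l _; rewrite bdiff_line enorm_line yF /W mul1r.
apply: has_deriv2_derive1; apply: has_deriv2_scale; apply: has_deriv2_sum => l.
exact: has_deriv2_comp_sqrt_quadratic.
Qed.

(** * Displacements with vanishing differences *)

Lemma periodic_mul {T : Type} (N : nat) (u : int -> T) :
  (forall l, u (l + N%:Z) = u l) -> forall l k : int, u (l + k * N%:Z) = u l.
Proof.
move=> uN l; elim/int_ind => [|n IH|n IH]; first by rewrite mul0r addr0.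
  by rewrite -addn1 PoszD mulrDl mul1r addrA uN IH.
by rewrite -addn1 PoszD opprD mulrDl -IH -[LHS]uN mulN1r addrA subrK.
Qed.

(** Vanishing differences make [u] constant over one period, the zero mean makes that constant 0,
    and periodicity carries this to all of the integers. *)
Lemma displacement_bdiff_eq0 {R : realType} N (u : int -> 'rV[R]_2) :
  (0 < N)%N -> displacements N u ->
  (forall l : nat, (1 <= l <= N)%N -> bdiff N u l%:Z = 0) -> u = 0.
Proof.
move=> N0 [uN us] u'0.
have uE (l : nat) : (l <= N)%N -> u l%:Z = u 0.
  elim: l => // l IH lN; rewrite -IH; last exact: ltnW.
  have /eqP := u'0 l.+1 lN; rewrite scaler_eq0 invrK pnatr_eq0 -[_ == 0%N]leqn0 leqNgt N0/=.
  by rewrite -[l.+1]addn1 PoszD addrK subr_eq0 => /eqP.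
have u0 : u 0 = 0.
  move: us; rewrite (@eq_big_nat _ _ _ _ _ _ (fun=> u 0)); last first.
    by move=> l /andP[_ lN]; exact: uE.
  rewrite sumr_const_nat subn1/= -scaler_nat => /eqP.
  by rewrite scaler_eq0 pnatr_eq0 -[_ == 0%N]leqn0 leqNgt N0/= => /eqP.
apply/funext => l; rewrite (divz_eq l N%:Z) addrC (periodic_mul _ _ uN).
have NZ : N%:Z != 0 by rewrite eqz_nat -lt0n.
have := modz_ge0 l NZ; have : (l %% N%:Z < N%:Z)%Z by apply: ltz_pmod; rewrite ltz_nat.
case: (l %% N%:Z)%Z => // n nN _; by rewrite uE ?u0// ltnW// -ltz_nat.
Qed.

(** * Bond length, rotation and closure of the circle *)

(** Neighbours subtend the angle [2 pi eps], so their chord is [2 rad sin(pi eps) = F eps] up to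
    sign; dividing by [eps] leaves length [F]. *)
Lemma uniform_circular_spacing {R : realType} (F : R) N (y : int -> 'rV[R]_2) :
  (0 < N)%N -> 0 < F -> uniform_circular F N y ->
  forall l, enorm (bdiff N y l) = F.
Proof.
move=> N0 F0 [rad radE [Q QQ [c yE]]] l.
have e0 : 0 < eps N :> R by rewrite invr_gt0 ltr0n.
rewrite /bdiff !yE opprD addrACA subrr addr0.
rewrite -mulmxBl scalemxAl enorm_orthogonal//.
rewrite -[RHS]gtr0_norm// -[RHS]sqrtr_sqr enorm_sqrt_sq; congr Num.sqrt.
rewrite enorm_sq /dot !big_ord_recl big_ord0 !mxE/= addr0.
set a := 2 * pi * eps N * l%:~R.
have -> : 2 * pi * eps N * (l - 1)%:~R = a - (pi * eps N) *+ 2 :> R.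
  by rewrite /a intrB; ring.
set x := pi * eps N in radE *.
have := cos2Dsin2 a.
have := cos_mulr2n x; have := cos2Dsin2 x.
have := cosB a (a - x *+ 2).
rewrite subKr.
have := cos2Dsin2 (a - x *+ 2).
set C := cos (a - _); set S := sin (a - _).
set A := cos a; set B := sin a; set X := cos x; set Y := sin x.
move=> h1 h2 h3 h4 h5.
have FE : F = (eps N)^-1 * (2 * rad * sin x) by rewrite -radE mulrC mulfK// gt_eqF.
rewrite FE -/Y; set e := (eps N)^-1.
(* Law of cosines: the bracket equals [2 - 2 cos(2 x)], which is [4 sin(x) ^ 2] by the double angle
   formula. *)
transitivity (e ^+ 2 * rad ^+ 2 * ((A ^+ 2 + B ^+ 2) + (C ^+ 2 + S ^+ 2) - 2 * (A * C + B * S))).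
  ring.
rewrite h1 h5 -h2 h4.
have -> : X ^+ 2 = 1 - Y ^+ 2 by rewrite -h3 addrK.
ring.
Qed.

(** Acting on row vectors from the right, it sends [(a, b)] to [(-b, a)]. *)
Definition rot90 {R : realType} : 'M[R]_2 :=
  \matrix_(i, j) if i == j then 0 else if i == 0 then 1 else -1.

Lemma rot90_orthogonal {R : realType} : rot90 *m rot90^T = 1%:M :> 'M[R]_2.
Proof.
apply/matrixP => i j; rewrite !mxE !big_ord_recl big_ord0 !mxE.
by case: i => [[|[|]]]//= ?; case: j => [[|[|]]]//= ?; ring.
Qed.

Lemma dot_rot90 {R : realType} (x : 'rV[R]_2) : dot x (x *m rot90) = 0.
Proof.
rewrite /dot !big_ord_recl !big_ord0 !mxE !big_ord_recl !big_ord0 !mxE/=.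
ring.
Qed.

Lemma displacements_mulmx {R : realType} N (u : int -> 'rV[R]_2) (A : 'M[R]_2) :
  displacements N u -> displacements N (fun l => u l *m A).
Proof.
move=> [uN us]; split; first by move=> l /=; rewrite uN.
by rewrite -mulmx_suml us mul0mx.
Qed.

Lemma displacements_center {R : realType} N (y : int -> 'rV[R]_2) :
  (0 < N)%N -> (forall l, y (l + N%:Z) = y l) ->
  displacements N (fun l => y l - eps N *: \sum_(1 <= k < N.+1) y k%:Z).
Proof.
move=> N0 yN; split; first by move=> l /=; rewrite yN.
rewrite sumrB sumr_const_nat subn1/= -scaler_nat scalerA divff ?scale1r ?subrr//.
by rewrite pnatr_eq0 -lt0n.
Qed.

Lemma uniform_circular_periodic {R : realType} (F : R) N (y : int -> 'rV[R]_2) :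
  (0 < N)%N -> uniform_circular F N y -> forall l, y (l + N%:Z) = y l.
Proof.
move=> N0 yC l; rewrite (uniform_circular_deformation N0 yC).
move: yC => [rad _ [Q _ [c yE]]].
have -> : y N%:Z = y 0; last by rewrite subrr addr0.
rewrite !yE; congr (_ *m Q + c); apply/rowP => i; rewrite !mxE.
have -> : 2 * pi * eps N * (N%:Z)%:~R = 0 + pi *+ 2 :> R.
  by rewrite -pmulrn -mulrA mulVf ?mulr1 ?add0r ?mulr_natl// pnatr_eq0 -lt0n.
by rewrite mulr0z mulr0 cosD2pi sinD2pi.
Qed.

(** * Bounds on the Rayleigh quotient *)

(** Cauchy-Schwarz gives [t ^ 2 <= m] on each bond, so both [t ^ 2] and [m - t ^ 2] are nonnegative
    and replacing either modulus by the minimum can only lower the sum. *)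
Lemma second_variationCB_ge {R : realType} (phi : R -> R) (F : R) N
    (y u : int -> 'rV[R]_2) :
  C2_pos phi -> 0 < F -> (forall l, enorm (bdiff N y l) = F) ->
  Num.min (tangential_modulus phi F) (normal_modulus phi F)
    * l2norm N (bdiff N u) ^+ 2 <= second_variation (energyCB phi N) y u u.
Proof.
move=> C2 F0 yF; rewrite (second_variationCB _ F)// l2norm_sq mulrCA.
rewrite ler_wpM2l ?invr_ge0// mulr_sumr; apply: ler_sum => l _.
set t := dot _ _ / F; set m := enorm _ ^+ 2.
have tm : t ^+ 2 <= m.
  rewrite /t expr_div_n ler_pdivrMr ?exprn_gt0// mulrC -(yF l%:Z).
  exact: dot_sq_le.
have t0 := sqr_ge0 t.
rewrite -{1}[m](subrKC (t ^+ 2)) mulrDr lerD//.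
  by rewrite ler_wpM2r// ge_min lexx.
by rewrite ler_wpM2r ?subr_ge0// ge_min lexx orbT.
Qed.

Lemma l2norm_bdiff_gt0 {R : realType} N (u : int -> 'rV[R]_2) :
  (0 < N)%N -> displacements N u -> u <> 0 -> 0 < l2norm N (bdiff N u) ^+ 2.
Proof.
move=> N0 uU un0; rewrite lt0r sqr_ge0 andbT; apply/eqP.
rewrite l2norm_sq => /eqP; rewrite mulf_eq0 invr_eq0 pnatr_eq0 -leqn0 leqNgt N0/=.
rewrite psumr_eq0; last by move=> *; exact: sqr_ge0.
move=> /allP h; apply: un0; apply: (displacement_bdiff_eq0 N) => // l lN.
have := h l; rewrite mem_index_iota ltnS => /(_ lN); rewrite sqrf_eq0 => /eqP.
exact: enorm_eq0.
Qed.

Lemma l2norm_const {R : realType} (F : R) N (v : int -> 'rV[R]_2) :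
  (0 < N)%N -> (forall l, enorm (v l) = F) -> l2norm N v ^+ 2 = F ^+ 2.
Proof.
move=> N0 vF; rewrite l2norm_sq; under eq_bigr do rewrite vF.
rewrite sumr_const_nat subn1/= -[F ^+ 2 *+ N]mulr_natl mulrA mulVf ?mul1r//.
by rewrite pnatr_eq0 -lt0n.
Qed.

Lemma bdiff_neq0 {R : realType} (F : R) N (u : int -> 'rV[R]_2) :
  0 < F -> (forall l, enorm (bdiff N u l) = F) -> u <> 0.
Proof.
move=> F0 uF u0; have := uF 0; rewrite u0 /bdiff subrr scaler0.
rewrite enorm_sqrt_sq enorm_sq /dot big1 ?sqrtr0; first by move=> F0'; rewrite -F0' ltxx in F0.
by move=> i _; rewrite mxE mul0r.
Qed.

Theorem theorem5p1 (R : realType) (phi : R -> R) (F : R)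
    (phi_C2 : C2_pos phi) (F_gt0 : 0 < F) :
  exists r : nat -> R,
    (exists (C : R) (N0 : nat), forall N : nat,
       (N0 <= N)%N -> odd N -> `|r N| <= C * eps N) /\
    (forall (N : nat) (yF : int -> 'rV[R]_2),
       (3 <= N)%N -> uniform_circular F N yF ->
       ereal_inf [set (second_variation (energyCB phi N) yF u u
                       / l2norm N (bdiff N u) ^+ 2)%:E
                 | u in displacements N `\ (0 : int -> 'rV[R]_2)] =
       (if odd N
        then Num.min (derive1n 2 phi F + 4 * derive1n 2 phi (2 * F))
                     ((derive1 phi F + 2 * derive1 phi (2 * F)) / F + r N)
        else Num.min (derive1n 2 phi F + 4 * derive1n 2 phi (2 * F))
                     ((derive1 phi F + 2 * derive1 phi (2 * F)) / F))%:E).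
Proof.
exists (fun=> 0); split.
  by exists 0, 0%N => N _ _; rewrite normr0 mul0r.
move=> N y N3 yC; rewrite addr0 if_same.
rewrite -/(tangential_modulus phi F) -/(normal_modulus phi F).
have N0 : (0 < N)%N by apply: leq_trans N3.
have yF := uniform_circular_spacing _ _ _ N0 F_gt0 yC.
have yN := uniform_circular_periodic _ _ _ N0 yC.
have F2 : F ^+ 2 != 0 by rewrite expf_neq0// gt_eqF.
pose u l := y l - eps N *: \sum_(1 <= k < N.+1) y k%:Z.
have uU : displacements N u by exact: displacements_center.
have u'E l : bdiff N u l = bdiff N y l by rewrite /bdiff /u opprB addrA subrK.
have u'F l : enorm (bdiff N u l) = F by rewrite u'E.
pose v l := u l *m rot90.
have vU : displacements N v by exact: displacements_mulmx.
have v'E l : bdiff N v l = bdiff N y l *m rot90.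
  by rewrite -u'E /bdiff /v -mulmxBl scalemxAl.
have v'F l : enorm (bdiff N v l) = F.
  by rewrite v'E enorm_orthogonal ?rot90_orthogonal.
apply/eqP; rewrite eq_le; apply/andP; split; last first.
  apply: le_ereal_inf_tmp => _ [w [wU wn0] <-]; rewrite lee_fin.
  rewrite ler_pdivlMr ?l2norm_bdiff_gt0//.
  exact: second_variationCB_ge.
(* The infimum is attained: by the dilation [u] if the tangential modulus is strictly smaller, by
   the rotation [v] otherwise. *)
apply: ereal_inf_lbound; rewrite /Num.min; case: ifPn => _.
  exists u; first by split => //; exact: bdiff_neq0 u'F.
  congr EFin; rewrite (second_variationCB _ F)// (l2norm_const F)//.
  apply: (mulIf F2); rewrite divfK//.
  (* Writing [F ^ 2] as the squared norm of [y'] allows a comparison bond by bond. Here [t = F], so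
     the normal term vanishes. *)
  rewrite -(l2norm_const F _ _ N0 yF) l2norm_sq mulrCA; congr (_ * _).
  rewrite mulr_sumr; apply: eq_bigr => l _.
  by rewrite u'E -enorm_sq !yF /=; field; rewrite gt_eqF.
exists v; first by split => //; exact: bdiff_neq0 v'F.
congr EFin; rewrite (second_variationCB _ F)// (l2norm_const F)//.
apply: (mulIf F2); rewrite divfK//.
(* Here [t = 0], because a quarter turn of [y'] is orthogonal to it; only the normal term
   remains. *)
rewrite -(l2norm_const F _ _ N0 yF) l2norm_sq mulrCA; congr (_ * _).
rewrite mulr_sumr; apply: eq_bigr => l _.
by rewrite v'F v'E dot_rot90 yF /= mul0r expr0n/= mulr0 add0r subr0.
Qed.
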